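(* Let $\Sigma$ be a derivation of $\Gamma\vdash M:A$ in system $\mathcal N$ and let $(\Pi_M,E_M)=\mathrm{PD}_{\min}(M)$. Then there is a solution $(\bar{\mathsf e},\psi)$ of $(\Pi_M,E_M)$ such that $\Sigma=\mathsf m\circ\psi\circ\bar{\mathsf e}(\Pi_M)$.
   Context: $\lambda$-terms: $M,N::=x\mid\lambda x.M\mid MN$. Intersection types $\mathbf T$: $A::=a\mid\mu\to A$, with $a$ in a countable set $\mathbf V$ of type variables and $\mu=[A_1,\dots,A_n]$ ($n\ge0$) a finite multiset of types. A type environment $\Gamma$ maps term variables to multisets, all but finitely many to $[\,]$; $(\Gamma\uplus\Delta)(x)=\Gamma(x)\uplus\Delta(x)$; $\Gamma\setminus x$ agrees with $\Gamma$ except that it maps $x$ to $[\,]$. System $\mathcal N$ has rules: (var) $x:[A]\vdash x:A$; (abs) from $\Gamma\vdash M:A$ infer $\Gamma\setminus x\vdash\lambda x.M:\Gamma(x)\to A$; (many) from $\Gamma_i\vdash M:A_i$ ($1\le i\le n$, $n\ge0$) infer $\biguplus_i\Gamma_i\vdash M:[A_1,\dots,A_n]$; (app) from $\Gamma\vdash M:\mu\to A$ and $\Delta\vdash N:\mu$ infer $\Gamma\uplus\Delta\vdash MN:A$. Pre-types: ${\tt A}::={\tt a}\mid\sigma\to{\tt A}$, ${\tt a}$ in a countable set $\mathbf V_{\tt p}$ of pre-type variables, $\sigma=\langle{\tt A}_1,\dots,{\tt A}_n\rangle$ ($n\ge0$) a finite ordered list; $\cdot$ is list concatenation. Pre-type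 environments $\mathtt\Gamma$ map term variables to lists (all but finitely many empty), with pointwise concatenation and analogous notations. Disjoint = sharing no pre-type variable; fresh = occurring nowhere else. A pseudo-derivation for $M$ is a pair $(\Pi,E_\Pi)$, $\Pi$ a tree with ordered premises and $E_\Pi$ a set of equations, built by: (var) $x:\langle{\tt a}\rangle\vdash_{\tt p}x:{\tt a}$, $E=\emptyset$; (abs) from $\Sigma\triangleright\mathtt\Gamma\vdash_{\tt p}M:{\tt a}$, ${\tt b}$ fresh, infer $\mathtt\Gamma\setminus x\vdash_{\tt p}\lambda x.M:{\tt b}$, $E=E_\Sigma\cup\{{\tt b}\doteq\mathtt\Gamma(x)\to{\tt a}\}$; (many) from pairwise disjoint $\Sigma_i\triangleright\mathtt\Gamma_i\vdash_{\tt p}M:{\tt a}_i$ ($1\le i\le n$, $n\ge0$) infer $\mathtt\Gamma_1\cdot\ldots\cdot\mathtt\Gamma_n\vdash_{\tt p}M:\langle{\tt a}_1,\dots,{\tt a}_n\rangle$, $E=\bigcup_iE_{\Sigma_i}$; (app) from disjoint $\Sigma_1\triangleright\mathtt\Gamma\vdash_{\tt p}M:{\tt a}$ and $\Sigma_2\triangleright\mathtt\Delta\vdash_{\tt p}N:\langle{\tt b}_1,\dots,{\tt b}_n\rangle$, ${\tt c}$ fresh, infer $\mathtt\Gamma\cdot\mathtt\Delta\vdash_{\tt p}MN:{\tt c}$, $E=E_{\Sigma_1}\cup E_{\Sigma_2}\cup\{{\tt a}\doteq\langle{\tt b}_1,\dots,{\tt b}_n\rangle\to{\tt c}\}$. Pseudo-derivations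 are taken modulo renaming of pre-type variables. $\mathrm{PD}_{\min}(M)$ is the pseudo-derivation with $n=1$ in every (many) rule. Substitutions $\psi:\mathbf V_{\tt p}\to$ pre-types extend homomorphically; $\psi$ solves a set of equations if it equalizes both sides of each. $\mathsf m$: $\mathsf m({\tt a})=a$ (injective on variables), $\mathsf m(\sigma\to{\tt A})=\mathsf m(\sigma)\to\mathsf m({\tt A})$, $\mathsf m(\langle{\tt A}_1,\dots,{\tt A}_n\rangle)=[\mathsf m({\tt A}_1),\dots,\mathsf m({\tt A}_n)]$, extended to environments and trees. Expansion $\mathsf{Exp}(\sigma,n)$ ($\sigma\neq\langle\rangle$, $n\ge1$): if $\sigma=\langle{\tt a}_1,\dots,{\tt a}_m\rangle$ is the list in the conclusion of a (many) rule of $\Pi$ with subject $N$, replace the subtree rooted there by a (many) rule whose $m+n$ premises are fresh pairwise disjoint copies $\Sigma_i\triangleright\mathtt\Gamma_i\vdash_{\tt p}N:{\tt a}_i$ of $\mathrm{PD}_{\min}(N)$, recomputing equations; otherwise leave $\Pi$ unchanged. Erasure $\mathsf{Er}(\sigma,n)$: the same but with $\max(m-n,0)$ premises. A solution of $(\Pi,E)$ is a pair $(\bar{\mathsf e},\psi)$, $\bar{\mathsf e}$ a finite sequence of expansions and erasures, $\psi$ solving the equation set of $\bar{\mathsf e}(\Pi,E)$. *)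

(* Defs.v *)
From Stdlib Require Import Arith List Permutation Lia.
Import ListNotations.

Definition var := nat.

Inductive term : Type :=
| Var (x : var)
| Lam (x : var) (M : term)
| App (M N : term).

(** * Judgements and derivation trees

    [X] is either the type of types or the type of pre-types.  A multiset is
    represented by a list, considered up to [mset_eq] (below), so that multiset
    union and list concatenation are both [++].  Finite support of environments
    is not imposed: it holds in every derivation, see [Nder_finite_support]. *)

Definition env (X : Type) := var -> list X.

Definition esingle {X} (x : var) (A : X) : env X :=
  fun y => if Nat.eq_dec y x then [A] else [].
Definition eremove {X} (Γ : env X) (x : var) : env X :=
  fun y => if Nat.eq_dec y x then [] else Γ y.
Definition ecat {X} (Γ Δ : env X) : env X := fun y => Γ y ++ Δ y.
Definition ebig {X} (Γs : list (env X)) : env X :=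
  fold_right ecat (fun _ => []) Γs.

(** [Γ ⊢ M : A] is [Judg Γ M (inl A)] and [Γ ⊢ M : [A1,...,An]] is
    [Judg Γ M (inr [A1;...;An])]. *)
Record judg (X : Type) := Judg { jenv : env X; jsubj : term; jtype : X + list X }.
Arguments Judg {X}.
Arguments jenv {X}.
Arguments jsubj {X}.
Arguments jtype {X}.

Inductive rule := Rvar | Rabs | Rmany | Rapp.

Inductive tree (X : Type) : Type :=
| Node (r : rule) (j : judg X) (ts : list (tree X)).
Arguments Node {X}.

Definition concl {X} (t : tree X) : judg X := let 'Node _ j _ := t in j.

Definition judg_map {X Y} (f : X -> Y) (j : judg X) : judg Y :=
  Judg (fun x => map f (jenv j x)) (jsubj j)
       (match jtype j with inl A => inl (f A) | inr σ => inr (map f σ) end).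

Fixpoint tree_map {X Y} (f : X -> Y) (t : tree X) : tree Y :=
  let 'Node r j ts := t in Node r (judg_map f j) (map (tree_map f) ts).

(** * System N *)

Inductive ty : Type :=
| TVar (a : nat)
| TArr (μ : list ty) (A : ty).

(** Equality of multisets whose elements are compared by [R]. *)
Inductive mset_eq {X} (R : X -> X -> Prop) (l l' : list X) : Prop :=
| mset_eq_intro (k : list X) : Forall2 R l k -> Permutation k l' -> mset_eq R l l'.

(** Equality of types, the domain of each arrow being a multiset. *)
Inductive ty_eq : ty -> ty -> Prop :=
| ty_eq_var a : ty_eq (TVar a) (TVar a)
| ty_eq_arr μ ν A B :
    mset_eq ty_eq μ ν -> ty_eq A B -> ty_eq (TArr μ A) (TArr ν B).

Definition jtype_eq (T U : ty + list ty) : Prop :=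
  match T, U with
  | inl A, inl B => ty_eq A B
  | inr μ, inr ν => mset_eq ty_eq μ ν
  | _, _ => False
  end.

Definition judg_eq (j j' : judg ty) : Prop :=
  (forall x, mset_eq ty_eq (jenv j x) (jenv j' x)) /\
  jsubj j = jsubj j' /\ jtype_eq (jtype j) (jtype j').

(** Equality of derivations: the premises of (many) form a multiset, whereas
    those of the other rules are positional. *)
Inductive tree_eq : tree ty -> tree ty -> Prop :=
| tree_eq_many j j' ts ts' :
    judg_eq j j' -> mset_eq tree_eq ts ts' ->
    tree_eq (Node Rmany j ts) (Node Rmany j' ts')
| tree_eq_other r j j' ts ts' :
    r <> Rmany -> judg_eq j j' -> Forall2 tree_eq ts ts' ->
    tree_eq (Node r j ts) (Node r j' ts').

(** The comparisons up to [judg_eq] and [mset_eq] only account for the choice of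
    lists representing the multisets. *)
Inductive Nder : tree ty -> Prop :=
| N_var j x A :
    judg_eq j (Judg (esingle x A) (Var x) (inl A)) ->
    Nder (Node Rvar j [])
| N_abs j x Γ M A d :
    Nder d -> concl d = Judg Γ M (inl A) ->
    judg_eq j (Judg (eremove Γ x) (Lam x M) (inl (TArr (Γ x) A))) ->
    Nder (Node Rabs j [d])
| N_many j M (ps : list (env ty * ty)) ds :
    Forall Nder ds ->
    map concl ds = map (fun p => Judg (fst p) M (inl (snd p))) ps ->
    judg_eq j (Judg (ebig (map fst ps)) M (inr (map snd ps))) ->
    Nder (Node Rmany j ds)
| N_app j Γ Δ M N μ ν A d1 d2 :
    Nder d1 -> concl d1 = Judg Γ M (inl (TArr μ A)) ->
    Nder d2 -> concl d2 = Judg Δ N (inr ν) ->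
    mset_eq ty_eq μ ν ->
    judg_eq j (Judg (ecat Γ Δ) (App M N) (inl A)) ->
    Nder (Node Rapp j [d1; d2]).

Definition derivation_of (Σ : tree ty) (Γ : env ty) (M : term) (A : ty) : Prop :=
  Nder Σ /\ concl Σ = Judg Γ M (inl A).

(** * Pre-types *)

Inductive pty : Type :=
| PTVar (a : nat)
| PTArr (σ : list pty) (A : pty).

Fixpoint psubst (ψ : nat -> pty) (A : pty) : pty :=
  match A with
  | PTVar a => ψ a
  | PTArr σ B => PTArr (map (psubst ψ) σ) (psubst ψ B)
  end.

(** The map [m]: the list in the image is read as a multiset. *)
Fixpoint collapse (A : pty) : ty :=
  match A with
  | PTVar a => TVar a
  | PTArr σ B => TArr (map collapse σ) (collapse B)
  end.

Definition equation : Type := pty * pty.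

Definition solves (ψ : nat -> pty) (E : list equation) : Prop :=
  forall A B, In (A, B) E -> psubst ψ A = psubst ψ B.

(** * Pseudo-derivations

    All judgements of a pseudo-derivation are determined by the rules used and
    by the pre-type variables introduced by (var), (abs) and (app), so only those
    are stored; [ptree] recovers the tree of judgements.  The right premise of
    (app) always ends with (many): [PApp c Π N Πs] is an (app) whose right
    premise is the (many) with subject [N] and premises [Πs]. *)

Inductive pd : Type :=
| PVar (a : nat) (x : var)
| PAbs (b : nat) (x : var) (Π : pd)
| PApp (c : nat) (Π : pd) (N : term) (Πs : list pd).

Fixpoint psubj (Π : pd) : term :=
  match Π with
  | PVar _ x => Var x
  | PAbs _ x Σ => Lam x (psubj Σ)
  | PApp _ Σ N _ => App (psubj Σ) N
  end.

Definition proot (Π : pd) : nat :=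
  match Π with PVar a _ => a | PAbs b _ _ => b | PApp c _ _ _ => c end.

Definition ptype (Π : pd) : pty := PTVar (proot Π).

Fixpoint penv (Π : pd) : env pty :=
  match Π with
  | PVar a x => esingle x (PTVar a)
  | PAbs _ x Σ => eremove (penv Σ) x
  | PApp _ Σ _ Σs => ecat (penv Σ) (ebig (map penv Σs))
  end.

Definition pconcl (Π : pd) : judg pty := Judg (penv Π) (psubj Π) (inl (ptype Π)).

Fixpoint ptree (Π : pd) : tree pty :=
  match Π with
  | PVar _ _ => Node Rvar (pconcl Π) []
  | PAbs _ _ Σ => Node Rabs (pconcl Π) [ptree Σ]
  | PApp _ Σ N Σs =>
      Node Rapp (pconcl Π)
        [ptree Σ;
         Node Rmany (Judg (ebig (map penv Σs)) N (inr (map ptype Σs)))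
              (map ptree Σs)]
  end.

(** The set of equations [E_Π]. *)
Fixpoint eqs (Π : pd) : list equation :=
  match Π with
  | PVar _ _ => []
  | PAbs b x Σ => (PTVar b, PTArr (penv Σ x) (ptype Σ)) :: eqs Σ
  | PApp c Σ _ Σs =>
      (ptype Σ, PTArr (map ptype Σs) (PTVar c)) :: eqs Σ ++ flat_map eqs Σs
  end.

(** The variables occurring in an environment of [ptree Π] or in [eqs Π] are
    among these, since they all come from the type of some node. *)
Fixpoint pvars (Π : pd) : list nat :=
  match Π with
  | PVar a _ => [a]
  | PAbs b _ Σ => b :: pvars Σ
  | PApp c Σ _ Σs => c :: pvars Σ ++ flat_map pvars Σs
  end.

Definition pdisjoint (Π Π' : pd) : Prop :=
  forall a, In a (pvars Π) -> ~ In a (pvars Π').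

Inductive is_pd : pd -> Prop :=
| is_pd_var a x : is_pd (PVar a x)
| is_pd_abs b x Σ : is_pd Σ -> ~ In b (pvars Σ) -> is_pd (PAbs b x Σ)
| is_pd_app c Σ N Σs :
    is_pd Σ ->
    Forall is_pd Σs -> Forall (fun Σ' => psubj Σ' = N) Σs ->
    ForallOrdPairs pdisjoint Σs ->
    Forall (pdisjoint Σ) Σs ->
    ~ In c (pvars Σ) -> Forall (fun Σ' => ~ In c (pvars Σ')) Σs ->
    is_pd (PApp c Σ N Σs).

(** Every (many) has exactly one premise. *)
Inductive unary_many : pd -> Prop :=
| unary_var a x : unary_many (PVar a x)
| unary_abs b x Σ : unary_many Σ -> unary_many (PAbs b x Σ)
| unary_app c Σ N Σ' :
    unary_many Σ -> unary_many Σ' -> unary_many (PApp c Σ N [Σ']).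

(** [Π] is a representative, modulo renaming, of [PD_min(M)]. *)
Definition is_pdmin (M : term) (Π : pd) : Prop :=
  is_pd Π /\ psubj Π = M /\ unary_many Π.

Fixpoint tsize (M : term) : nat :=
  match M with
  | Var _ => 1
  | Lam _ N => S (tsize N)
  | App P Q => S (tsize P + tsize Q)
  end.

(** The representative of [PD_min(M)] with variables [k, ..., k + tsize M - 1];
    see [pdmin_is_pdmin]. *)
Fixpoint pdmin (k : nat) (M : term) : pd :=
  match M with
  | Var x => PVar k x
  | Lam x N => PAbs k x (pdmin (S k) N)
  | App P Q => PApp k (pdmin (S k) P) Q [pdmin (S k + tsize P) Q]
  end.

(** * Expansions and erasures *)

(** Only lists of pre-type variables are needed as first arguments, since these
    are the only ones that occur as the conclusion of a (many). *)
Inductive op : Type :=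
| Exp (σ : list nat) (n : nat)
| Er (σ : list nat) (n : nat).

Definition op_ok (o : op) : Prop :=
  match o with Exp σ n | Er σ n => σ <> [] /\ 1 <= n end.

(** [p] pairwise disjoint copies of [PD_min(N)], with variables [>= k]. *)
Definition copies (k : nat) (N : term) (p : nat) : list pd :=
  map (fun i => pdmin (k + i * tsize N) N) (seq 0 p).

(** In a pseudo-derivation a nonempty [σ] is the conclusion of at most one
    (many), so at most one replacement takes place. *)
Fixpoint replace_many (σ : list nat) (p k : nat) (Π : pd) : pd :=
  match Π with
  | PVar a x => PVar a x
  | PAbs b x Σ => PAbs b x (replace_many σ p k Σ)
  | PApp c Σ N Σs =>
      if list_eq_dec Nat.eq_dec (map proot Σs) σ
      then PApp c Σ N (copies k N p)
      else PApp c (replace_many σ p k Σ) N (map (replace_many σ p k) Σs)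
  end.

Definition fresh (Π : pd) : nat := S (list_max (pvars Π)).

Definition apply_op (o : op) (Π : pd) : pd :=
  match o with
  | Exp σ n => replace_many σ (length σ + n) (fresh Π) Π
  | Er σ n => replace_many σ (length σ - n) (fresh Π) Π
  end.

Definition apply_ops (e : list op) (Π : pd) : pd :=
  fold_left (fun Π' o => apply_op o Π') e Π.

Definition solution (e : list op) (ψ : nat -> pty) (Π : pd) : Prop :=
  Forall op_ok e /\ solves ψ (eqs (apply_ops e Π)).

(** * Sanity checks *)

Lemma mset_eq_nil {X} (R : X -> X -> Prop) l : mset_eq R l [] -> l = [].
Proof.
  intros [k H P]. apply Permutation_sym, Permutation_nil in P. subst.
  now inversion H.
Qed.

Fixpoint Nder_finite_support (Σ : tree ty) (H : Nder Σ) {struct H} :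
  exists b, forall x, b <= x -> jenv (concl Σ) x = [].
Proof.
  destruct H as [j x A E | j x Γ M A d Hd Ed E | j M ps ds Hds Eds E
                | j Γ Δ M N μ ν A d1 d2 H1 E1 H2 E2 _ E]; simpl;
    destruct E as [E _]; simpl in E.
  - exists (S x). intros y Hy. specialize (E y). unfold esingle in E.
    destruct (Nat.eq_dec y x); [lia|]. now apply mset_eq_nil in E.
  - destruct (Nder_finite_support _ Hd) as [b Hb]. rewrite Ed in Hb.
    exists b. intros y Hy. specialize (E y). unfold eremove in E.
    simpl in Hb. rewrite (Hb y Hy) in E.
    destruct (Nat.eq_dec y x); now apply mset_eq_nil in E.
  - assert (exists b, forall x, b <= x -> ebig (map fst ps) x = []) as [b Hb].
    { clear E. revert ps Eds.
      induction Hds as [|d ds Hd Hds IH]; intros [|p ps] Eds; try discriminate.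
      - now exists 0.
      - simpl in Eds. injection Eds as Ed Eds.
        destruct (IH ps Eds) as [b1 B1].
        destruct (Nder_finite_support _ Hd) as [b2 B2]. rewrite Ed in B2.
        exists (b1 + b2). intros y Hy. simpl in *. unfold ecat.
        rewrite B1, B2 by lia. reflexivity. }
    exists b. intros y Hy. specialize (E y). rewrite (Hb y Hy) in E.
    now apply mset_eq_nil in E.
  - destruct (Nder_finite_support _ H1) as [b1 B1]. rewrite E1 in B1.
    destruct (Nder_finite_support _ H2) as [b2 B2]. rewrite E2 in B2.
    exists (b1 + b2). intros y Hy. specialize (E y). unfold ecat in E.
    simpl in *. rewrite B1, B2 in E by lia. now apply mset_eq_nil in E.
Qed.

Lemma pdmin_vars M : forall k a, In a (pvars (pdmin k M)) -> k <= a < k + tsize M.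
Proof.
  induction M as [x|x M IH|P IHP Q IHQ]; simpl; intros k a.
  - lia.
  - intros [<-|H]; [lia|]. apply IH in H. lia.
  - rewrite app_nil_r. intros [<-|H]; [lia|].
    apply in_app_or in H as [H|H]; [apply IHP in H | apply IHQ in H]; lia.
Qed.

Lemma pdmin_is_pdmin M : forall k, is_pdmin M (pdmin k M).
Proof.
  induction M as [x|x M IH|P IHP Q IHQ]; intros k.
  - repeat split; constructor.
  - destruct (IH (S k)) as (H1 & H2 & H3). repeat split; simpl.
    + constructor; trivial. intros H. apply pdmin_vars in H. lia.
    + now rewrite H2.
    + now constructor.
  - destruct (IHP (S k)) as (H1 & H2 & H3).
    destruct (IHQ (S k + tsize P)) as (H4 & H5 & H6).
    repeat split; simpl.
    + constructor; repeat constructor; trivial.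
      * intros a Ha Hb. apply pdmin_vars in Ha, Hb. lia.
      * intros H. apply pdmin_vars in H. lia.
      * intros H. apply pdmin_vars in H. lia.
    + now rewrite H2.
    + now constructor.
Qed.

Definition pd_nested_ind (P : pd -> Prop)
    (Hvar : forall a x, P (PVar a x))
    (Habs : forall b x Σ, P Σ -> P (PAbs b x Σ))
    (Happ : forall c Σ N Σs, P Σ -> Forall P Σs -> P (PApp c Σ N Σs)) :
  forall Π, P Π :=
  fix rec (Π : pd) : P Π :=
    match Π with
    | PVar a x => Hvar a x
    | PAbs b x Σ => Habs b x Σ (rec Σ)
    | PApp c Σ N Σs =>
        Happ c Σ N Σs (rec Σ)
          ((fix go l : Forall P l :=
              match l with
              | [] => Forall_nil P
              | Π' :: l' => Forall_cons Π' (rec Π') (go l')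
              end) Σs)
    end.

Lemma replace_many_psubj σ p k Π : psubj (replace_many σ p k Π) = psubj Π.
Proof.
  induction Π as [a x|b x Σ IH|c Σ N Σs IH _] using pd_nested_ind; simpl; trivial.
  - now rewrite IH.
  - destruct list_eq_dec; simpl; now rewrite ?IH.
Qed.

Lemma replace_many_id a σ p k Π :
  ~ In a (pvars Π) -> replace_many (a :: σ) p k Π = Π.
Proof.
  induction Π as [b x|b x Σ IH|c Σ N Σs IH IHs] using pd_nested_ind; simpl;
    intros H; trivial.
  - rewrite IH; tauto.
  - rewrite in_app_iff in H. destruct list_eq_dec as [e|_].
    + destruct Σs as [|Σ' Σs]; [discriminate|]. simpl in e. injection e as e _.
      exfalso. apply H. right; right. simpl. apply in_or_app; left.
      rewrite <- e. destruct Σ'; simpl; tauto.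
    + rewrite IH by tauto. f_equal. rewrite <- (map_id Σs) at 2.
      apply map_ext_in. intros Σ' HΣ'. rewrite Forall_forall in IHs.
      apply IHs; trivial. intros Ha. apply H. right; right.
      apply in_flat_map. eauto.
Qed.

Lemma copies_vars k N p Π a : In Π (copies k N p) -> In a (pvars Π) -> k <= a.
Proof.
  intros H Ha. apply in_map_iff in H as (i & <- & _). apply pdmin_vars in Ha. lia.
Qed.

Lemma replace_many_vars σ p k Π a :
  In a (pvars (replace_many σ p k Π)) -> In a (pvars Π) \/ k <= a.
Proof.
  induction Π as [b x|b x Σ IH|c Σ N Σs IH IHs] using pd_nested_ind; simpl.
  - tauto.
  - tauto.
  - destruct list_eq_dec as [_|_]; simpl; rewrite !in_app_iff, !in_flat_map;
      intros [H|[H|(Σ' & H1 & H2)]]; try tauto.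
    + right. eapply copies_vars; eassumption.
    + apply in_map_iff in H1 as (Σ1 & <- & H1). rewrite Forall_forall in IHs.
      destruct (IHs _ H1 H2); [left; right; right; eauto | tauto].
Qed.

Lemma copies_disjoint k N p : ForallOrdPairs pdisjoint (copies k N p).
Proof.
  unfold copies. generalize 0 as s. induction p as [|p IH]; intros s; simpl.
  - constructor.
  - constructor; trivial. apply Forall_forall. intros Π H b Hb Hb'.
    apply in_map_iff in H as (i & <- & Hi). apply in_seq in Hi.
    apply pdmin_vars in Hb, Hb'. nia.
Qed.

Lemma ForallOrdPairs_map_in {X Y} (R : X -> X -> Prop) (R' : Y -> Y -> Prop) f l :
  (forall x y, In x l -> In y l -> R x y -> R' (f x) (f y)) ->
  ForallOrdPairs R l -> ForallOrdPairs R' (map f l).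
Proof.
  intros Hf H. induction H as [|x l Hx H IH]; simpl; constructor.
  - apply Forall_map, Forall_forall. intros y Hy. rewrite Forall_forall in Hx.
    apply Hf; simpl; auto.
  - apply IH. intros y z Hy Hz. apply Hf; simpl; auto.
Qed.

Lemma replace_many_is_pd a σ p k Π :
  (forall b, In b (pvars Π) -> b < k) ->
  is_pd Π -> is_pd (replace_many (a :: σ) p k Π).
Proof.
  assert (Hdis : forall Π1 Π2,
    (forall b, In b (pvars Π1) -> b < k) -> (forall b, In b (pvars Π2) -> b < k) ->
    pdisjoint Π1 Π2 ->
    pdisjoint (replace_many (a :: σ) p k Π1) (replace_many (a :: σ) p k Π2)).
  { intros Π1 Π2 L1 L2 D b H1 H2.
    destruct (in_dec Nat.eq_dec a (pvars Π1)) as [i|i].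
    - assert (j := D _ i). rewrite (replace_many_id _ _ _ _ _ j) in H2.
      apply replace_many_vars in H1 as [H1|H1]; [now apply (D b)|].
      apply L2 in H2. lia.
    - rewrite (replace_many_id _ _ _ _ _ i) in H1.
      apply replace_many_vars in H2 as [H2|H2]; [now apply (D b)|].
      apply L1 in H1. lia. }
  assert (Hfr : forall b Π, b < k -> ~ In b (pvars Π) ->
    ~ In b (pvars (replace_many (a :: σ) p k Π))).
  { intros b Π' Hb H H'. apply replace_many_vars in H' as [H'|H']; [auto|lia]. }
  induction Π as [b x|b x Σ IH|c Σ N Σs IH IHs] using pd_nested_ind;
    intros L H; cbn [replace_many]; trivial.
  - inversion H; subst. constructor.
    + apply IH; trivial. intros d Hd. apply L. now right.
    + apply Hfr; trivial. apply L. now left.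
  - inversion H; subst.
    assert (Lc : c < k) by (apply L; now left).
    assert (LΣ : forall b, In b (pvars Σ) -> b < k).
    { intros b Hb. apply L. right. apply in_or_app. now left. }
    assert (LΣs : forall Σ', In Σ' Σs -> forall b, In b (pvars Σ') -> b < k).
    { intros Σ' HΣ' b Hb. apply L. right. apply in_or_app. right.
      apply in_flat_map. eauto. }
    rewrite !Forall_forall in *.
    destruct list_eq_dec as [_|_]; constructor; rewrite ?Forall_forall; auto.
    + intros Σ' HΣ'. apply in_map_iff in HΣ' as (i & <- & _).
      apply pdmin_is_pdmin.
    + intros Σ' HΣ'. apply in_map_iff in HΣ' as (i & <- & _).
      apply pdmin_is_pdmin.
    + apply copies_disjoint.
    + intros Σ' HΣ' b Hb Hb'. apply LΣ in Hb.
      pose proof (copies_vars _ _ _ _ _ HΣ' Hb'). lia.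
    + intros Σ' HΣ' Hb'. pose proof (copies_vars _ _ _ _ _ HΣ' Hb'). lia.
    + intros Σ1 H1. apply in_map_iff in H1 as (Σ' & <- & H1). eauto.
    + intros Σ1 H1. apply in_map_iff in H1 as (Σ' & <- & H1).
      rewrite replace_many_psubj. auto.
    + eapply ForallOrdPairs_map_in; [|eassumption]. intros; apply Hdis; eauto.
    + intros Σ1 H1. apply in_map_iff in H1 as (Σ' & <- & H1). apply Hdis; eauto.
    + intros Σ1 H1. apply in_map_iff in H1 as (Σ' & <- & H1). auto.
Qed.

Lemma fresh_lt Π b : In b (pvars Π) -> b < fresh Π.
Proof.
  intros H. unfold fresh. assert (list_max (pvars Π) <= list_max (pvars Π)) as L by lia.
  apply list_max_le in L. rewrite Forall_forall in L. apply L in H. lia.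
Qed.

Lemma apply_op_is_pd o Π :
  op_ok o -> is_pd Π -> is_pd (apply_op o Π) /\ psubj (apply_op o Π) = psubj Π.
Proof.
  destruct o as [[|a σ] n|[|a σ] n]; intros [Ho _] H; try easy;
    (split; [apply replace_many_is_pd; auto using fresh_lt
            | apply replace_many_psubj]).
Qed.

(* Main.v *)
(** Idea.  The equations of a pseudo-derivation compare ordered lists, so the
    point is to order all the multisets of [Σ] consistently.  A term fixes the
    order of the domains it abstracts over, namely that of the occurrences of the
    bound variable, and this order in turn depends on the orders chosen at the
    applications below it, so the choice cannot be made by a direct induction on
    [Σ].  A logical relation does it: the sets of pre-types representing [A] that
    are [total A] are nonempty, a set being total at an arrow if it sends total
    sets of arguments to a total set, and the types that the ordered versions of
    [Σ] can receive, when each occurrence of a free variable takes its type in a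
    given total set, form a total set.  This yields an ordered version of [Σ].
    Expansions and erasures turn [PD_min(M)] into a pseudo-derivation of the same
    shape, and as its variables are distinct they can be instantiated at will. *)

Require Import Defs.
From Stdlib Require Import Arith List Permutation Lia Cantor ClassicalEpsilon.
From Stdlib Require Import FunctionalExtensionality Relation_Operators.
Import ListNotations.

(** * Matching lists up to permutation *)

(** The heterogeneous version of [mset_eq]. *)
Definition matching {X Y} (R : X -> Y -> Prop) (l : list X) (m : list Y) : Prop :=
  exists k, Forall2 R l k /\ Permutation k m.

Lemma mset_eq_matching {X} (R : X -> X -> Prop) l m :
  mset_eq R l m <-> matching R l m.
Proof.
  split; [intros [k H P]; now exists k | intros (k & H & P); now exists k].
Qed.

Lemma Forall2_matching {X Y} (R : X -> Y -> Prop) l m :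
  Forall2 R l m -> matching R l m.
Proof. now exists m. Qed.

Lemma matching_flip {X Y} (R : X -> Y -> Prop) l m :
  matching R l m <-> matching (fun y x => R x y) m l.
Proof.
  assert (W : forall X Y (R : X -> Y -> Prop) l m,
    matching R l m -> matching (fun y x => R x y) m l).
  { intros X' Y' R' l' m' (k & H & P). apply Forall2_flip in H.
    destruct (Permutation_Forall2 P H) as (l1 & P' & H').
    exists l1; split; [trivial | now symmetry]. }
  split; apply W.
Qed.

Lemma matching_perm_r {X Y} (R : X -> Y -> Prop) l m m' :
  matching R l m -> Permutation m m' -> matching R l m'.
Proof. intros (k & H & P) P'. exists k. split; trivial. now rewrite P. Qed.

Lemma matching_perm_l {X Y} (R : X -> Y -> Prop) l l' m :
  matching R l m -> Permutation l l' -> matching R l' m.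
Proof.
  intros H P. apply matching_flip in H. apply matching_flip.
  now apply matching_perm_r with l.
Qed.

(** Membership in [l] is offered to the hypothesis because, in an induction on types, the induction
    hypothesis only covers the elements of the domain. *)
Lemma matching_trans_in {X Y Z} (R : X -> Y -> Prop) (S : Y -> Z -> Prop)
    (T : X -> Z -> Prop) l m n :
  (forall x y z, In x l -> R x y -> S y z -> T x z) ->
  matching R l m -> matching S m n -> matching T l n.
Proof.
  intros HT (k & H & P) H'. apply matching_perm_l with (l' := k) in H'; [|now symmetry].
  destruct H' as (n' & H' & P'). exists n'. split; trivial.
  clear P P'. revert n' H'. induction H as [|x y l k Hxy H IH]; intros n' H';
    inversion H'; subst; constructor.
  - apply HT with y; simpl; auto.
  - apply IH; trivial. intros x' y' z' Hx'. apply HT. now right.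
Qed.

Lemma matching_trans {X Y Z} (R : X -> Y -> Prop) (S : Y -> Z -> Prop)
    (T : X -> Z -> Prop) l m n :
  (forall x y z, R x y -> S y z -> T x z) ->
  matching R l m -> matching S m n -> matching T l n.
Proof. intros H. apply matching_trans_in. eauto. Qed.

Lemma matching_weaken_in {X Y} (R S : X -> Y -> Prop) l m :
  (forall x y, In x l -> R x y -> S x y) -> matching R l m -> matching S l m.
Proof.
  intros HS (k & H & P). exists k. split; trivial. clear P.
  induction H; constructor; simpl in *; auto.
Qed.

Lemma matching_app {X Y} (R : X -> Y -> Prop) l1 l2 m1 m2 :
  matching R l1 m1 -> matching R l2 m2 -> matching R (l1 ++ l2) (m1 ++ m2).
Proof.
  intros (k1 & H1 & P1) (k2 & H2 & P2). exists (k1 ++ k2).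
  split; [now apply Forall2_app | now apply Permutation_app].
Qed.

Lemma matching_app_inv {X Y} (R : X -> Y -> Prop) l1 l2 m :
  matching R (l1 ++ l2) m ->
  exists m1 m2, matching R l1 m1 /\ matching R l2 m2 /\ Permutation (m1 ++ m2) m.
Proof.
  intros (k & H & P). apply Forall2_app_inv_l in H as (m1 & m2 & H1 & H2 & ->).
  exists m1, m2. auto using Forall2_matching.
Qed.

Lemma matching_map_r {X Y Z} (R : X -> Z -> Prop) (f : Y -> Z) l m :
  matching R l (map f m) <-> matching (fun x y => R x (f y)) l m.
Proof.
  split.
  - intros (k & H & P). apply Permutation_map_inv in P as (k' & -> & P).
    exists k'. split; [|now symmetry]. clear P.
    revert l H. induction k' as [|y k' IH]; intros l H; inversion H; subst;
      constructor; auto.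
  - intros (k & H & P). exists (map f k). split; [|now apply Permutation_map].
    clear P. induction H; simpl; constructor; auto.
Qed.

Lemma matching_map_l {X Y Z} (R : X -> Z -> Prop) (f : Y -> X) l m :
  matching R (map f l) m <-> matching (fun y z => R (f y) z) l m.
Proof.
  rewrite !(matching_flip _ _ m). apply (matching_map_r (fun z x => R x z)).
Qed.

Lemma matching_singleton {X Y} (R : X -> Y -> Prop) x m :
  matching R [x] m <-> exists y, m = [y] /\ R x y.
Proof.
  split.
  - intros (k & H & P). inversion H as [|? y ? ? Hxy H0]; subst. inversion H0; subst.
    apply Permutation_length_1_inv in P. subst. eauto.
  - intros (y & -> & H). exists [y]. auto.
Qed.

Lemma matching_nil {X Y} (R : X -> Y -> Prop) m : matching R [] m <-> m = [].
Proof.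
  split.
  - intros (k & H & P). inversion H; subst. now apply Permutation_nil in P.
  - intros ->. exists []. auto.
Qed.

(** * Equality of types *)

Definition ty_nested_ind (P : ty -> Prop) (Hvar : forall a, P (TVar a))
    (Harr : forall μ B, Forall P μ -> P B -> P (TArr μ B)) : forall A, P A :=
  fix rec (A : ty) : P A :=
    match A with
    | TVar a => Hvar a
    | TArr μ B =>
        Harr μ B
          ((fix go l : Forall P l :=
              match l with
              | [] => Forall_nil P
              | C :: l' => Forall_cons C (rec C) (go l')
              end) μ) (rec B)
    end.

Lemma ty_eq_sym A B : ty_eq A B -> ty_eq B A.
Proof.
  revert B. induction A as [a|μ A IHμ IHA] using ty_nested_ind; intros B H;
    inversion H; subst; constructor; auto.
  rewrite Forall_forall in IHμ. rewrite mset_eq_matching in *.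
  apply matching_flip. eapply matching_weaken_in; [|eassumption]. simpl. auto.
Qed.

Lemma ty_eq_trans A B C : ty_eq A B -> ty_eq B C -> ty_eq A C.
Proof.
  revert B C. induction A as [a|μ A IHμ IHA] using ty_nested_ind; intros B C H H';
    inversion H; subst; inversion H'; subst; constructor; eauto.
  rewrite Forall_forall in IHμ. rewrite mset_eq_matching in *.
  eapply matching_trans_in; [|eassumption..]. simpl. eauto.
Qed.

Lemma matching_ty_eq_sym μ ν : matching ty_eq μ ν -> matching ty_eq ν μ.
Proof.
  intros H. apply matching_flip.
  eapply matching_weaken_in; [|eassumption]. auto using ty_eq_sym.
Qed.

Lemma matching_ty_eq_trans μ ν ξ :
  matching ty_eq μ ν -> matching ty_eq ν ξ -> matching ty_eq μ ξ.
Proof. apply matching_trans, ty_eq_trans. Qed.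

(** * Total sets of pre-types *)

(** [X] is read as a set of functions. The order in which the arguments drawn from [Us] are listed
    is left to [X], through the existential on [σ]. *)
Definition apply_set (X : pty -> Prop) (Us : list (pty -> Prop)) : pty -> Prop :=
  fun B' => exists σ, matching (fun A U => U A) σ Us /\ X (PTArr σ B').

(** The largest set that can be total at [A]. *)
Definition full (A : ty) : pty -> Prop := fun A' => ty_eq A (collapse A').

(** Arguments are matched positionally, through [map total μ], to keep the recursion structural;
    [total_arr] recovers the formulation up to permutation. *)
Fixpoint total (A : ty) (X : pty -> Prop) : Prop :=
  (forall A', X A' -> full A A') /\
  match A with
  | TVar a => X (PTVar a)
  | TArr μ B =>
      forall Us, Forall2 (fun (P : (pty -> Prop) -> Prop) U => P U) (map total μ) Us ->
        total B (apply_set X Us)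
  end.

Lemma total_full A X A' : total A X -> X A' -> full A A'.
Proof. destruct A; intros [H _]; apply H. Qed.

Lemma matching_full μ Us σ :
  matching total μ Us -> matching (fun A U => U A) σ Us ->
  matching ty_eq μ (map collapse σ).
Proof.
  intros Hμ Hσ. apply matching_map_r. apply matching_flip in Hσ.
  eapply matching_trans; [|eassumption..]. simpl. intros A U A' HU HA.
  now apply (total_full A U).
Qed.

(** Enlarging [X] enlarges [apply_set X Us], and at a variable totality asks for one particular
    member, so induction on [A] applies as long as [Y] stays within [full A]. *)
Lemma total_mono A X Y :
  total A X -> (forall A', X A' -> Y A') -> (forall A', Y A' -> full A A') ->
  total A Y.
Proof.
  revert X Y. induction A as [a|μ B _ IH] using ty_nested_ind; intros X Y [HX T] XY HY;
    simpl; split; auto.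
  intros Us HUs. apply IH with (apply_set X Us); auto.
  - intros B' (σ & Hσ & H). exists σ. auto.
  - intros B' (σ & Hσ & H). apply HY in H. now inversion H.
Qed.

Lemma apply_set_perm X Us Vs B' :
  Permutation Us Vs -> apply_set X Us B' -> apply_set X Vs B'.
Proof.
  intros P (σ & Hσ & H). exists σ. split; trivial. now apply matching_perm_r with Us.
Qed.

(** Reordering [Us] does not change [apply_set X Us], whose arguments are matched up to
    permutation. *)
Lemma total_arr μ B X :
  total (TArr μ B) X <->
  (forall A', X A' -> full (TArr μ B) A') /\
  (forall Us, matching total μ Us -> total B (apply_set X Us)).
Proof.
  split; intros [HX H]; split; trivial; intros Us HUs.
  - destruct HUs as (Vs & HVs & P).
    apply total_mono with (apply_set X Vs).
    + apply H. clear -HVs. induction HVs; simpl; auto.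
    + intros B'. now apply apply_set_perm.
    + intros B' (σ & Hσ & H'). apply HX in H'. now inversion H'.
  - apply H. apply (matching_map_l (fun P U => P U) total).
    now apply Forall2_matching.
Qed.

Lemma total_ty_eq A B X : ty_eq A B -> total A X <-> total B X.
Proof.
  revert B X. induction A as [a|μ A IHμ IHA] using ty_nested_ind; intros B X H;
    inversion H as [|? ν ? B0 Hμν HAB]; subst; [reflexivity|].
  rewrite mset_eq_matching in Hμν. rewrite Forall_forall in IHμ.
  assert (Hargs : forall Us, matching total μ Us <-> matching total ν Us).
  { assert (H' : matching (fun C D => forall U, total C U <-> total D U) μ ν).
    { eapply matching_weaken_in; [|exact Hμν]. simpl. intros; now apply IHμ. }
    intros Us. split; intros HUs.
    - apply matching_flip in H'. eapply matching_trans; [|exact H'|exact HUs].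
      simpl. intros D C U HCD. apply HCD.
    - eapply matching_trans; [|exact H'|exact HUs]. simpl. intros C D U HCD. apply HCD. }
  rewrite !total_arr.
  assert (Hfull : forall A', full (TArr μ A) A' <-> full (TArr ν B0) A').
  { intros A'. split; apply ty_eq_trans; [now apply ty_eq_sym|trivial]. }
  split; intros [HX T]; (split; [intros A' HA'; apply Hfull, HX, HA'|]);
    intros Us HUs; apply (IHA B0 _ HAB), T, Hargs, HUs.
Qed.

Lemma matching_total_ty_eq μ ν Us :
  matching ty_eq μ ν -> matching total μ Us -> matching total ν Us.
Proof.
  intros H. apply matching_ty_eq_sym in H. revert H. apply matching_trans.
  intros C D U HCD. now apply total_ty_eq.
Qed.

(** The two halves feed each other. For [full (TArr μ B)] to be total, an argument list must be
    drawn from given total sets, which is possible as these are inhabited. A set total at [TArr μ B]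
    is inhabited because it can be applied to the sets [full C], total by induction, with an
    inhabited result. *)
Lemma full_total_inhabited A :
  total A (full A) /\ (forall X, total A X -> exists A', X A').
Proof.
  induction A as [a|μ B IHμ [IHB1 IHB2]] using ty_nested_ind.
  - split.
    + split; [auto|constructor].
    + intros X [_ H]. eauto.
  - rewrite Forall_forall in IHμ. split.
    + apply total_arr. split; [auto|]. intros Us HUs.
      apply total_mono with (full B); trivial.
      * intros B' HB'.
        assert (exists σ, Forall2 (fun A U => U A) σ Us) as [σ Hσ].
        { apply matching_flip in HUs as (μ' & HUs & P).
          assert (H : forall C, In C μ' -> forall U, total C U -> exists C', U C').
          { intros C HC U. apply IHμ. now rewrite <- P. }
          clear -HUs H. induction HUs as [|U C Us μ' HU HUs IH].
          - now exists [].
          - destruct IH as [σ Hσ]; [intros; apply (H C0); simpl; auto|].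
            destruct (H C (or_introl eq_refl) U HU) as [C' HC'].
            exists (C' :: σ). auto. }
        exists σ. apply Forall2_matching in Hσ. split; trivial.
        constructor; trivial. apply mset_eq_matching.
        now apply matching_full with Us.
      * intros B' (σ & _ & H). now inversion H.
    + intros X H. apply total_arr in H as [_ H].
      destruct (IHB2 (apply_set X (map full μ))) as (B' & σ & _ & HX); eauto.
      apply H, matching_map_r, Forall2_matching. clear H.
      induction μ as [|C μ IH]; constructor.
      * now apply IHμ; left.
      * apply IH. intros D HD. apply IHμ. now right.
Qed.

(** * Realizers *)

Definition tree_nested_ind {X} (P : tree X -> Prop)
    (H : forall r j ts, Forall P ts -> P (Node r j ts)) : forall t, P t :=
  fix rec (t : tree X) : P t :=
    let 'Node r j ts := t in
    H r j ts
      ((fix go l : Forall P l :=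
          match l with
          | [] => Forall_nil P
          | u :: l' => Forall_cons u (rec u) (go l')
          end) ts).

Lemma tree_eq_concl t u : tree_eq t u -> judg_eq (concl t) (concl u).
Proof. now intros [? ? ? ? H _|? ? ? ? ? _ H _]. Qed.

Lemma concl_tree_map {X Y} (f : X -> Y) t :
  concl (tree_map f t) = judg_map f (concl t).
Proof. now destruct t. Qed.

Lemma concl_ptree Π : concl (ptree Π) = pconcl Π.
Proof. now destruct Π. Qed.

(** [Π] is a pseudo-derivation for [M], except that its variables need not be
    distinct. *)
Fixpoint pd_of (M : term) (Π : pd) : Prop :=
  match M, Π with
  | Var x, PVar _ y => y = x
  | Lam x N, PAbs _ y Σ => y = x /\ pd_of N Σ
  | App P Q, PApp _ Σ N Σs => pd_of P Σ /\ N = Q /\ Forall (pd_of Q) Σs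
  | _, _ => False
  end.

Lemma pd_of_psubj M Π : pd_of M Π -> psubj Π = M.
Proof.
  revert Π. induction M as [x|x M IH|P IHP Q _]; intros [b y|b y Σ|c Σ N Σs];
    simpl; try easy.
  - now intros ->.
  - intros [-> H]. now rewrite IH.
  - intros (H & -> & _). now rewrite IHP.
Qed.

Definition reading (ψ : nat -> pty) (t : tree pty) : tree ty :=
  tree_map collapse (tree_map (psubst ψ) t).

Definition ptree_many (N : term) (Πs : list pd) : tree pty :=
  Node Rmany (Judg (ebig (map penv Πs)) N (inr (map ptype Πs))) (map ptree Πs).

(** Environments are consumed linearly: each set in [γ x] supplies exactly one entry of [E x], in an
    unspecified order. *)
Definition env_in (ψ : nat -> pty) (E : env pty) (γ : env (pty -> Prop)) : Prop :=
  forall x, matching (fun A U => U A) (map (psubst ψ) (E x)) (γ x).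

(** [ψ] will be a surjection, so that the labels of [Π] merely encode arbitrary
    pre-types and no freshness has to be maintained when realizers are combined. *)
Definition realizer (ψ : nat -> pty) (γ : env (pty -> Prop)) (t : tree ty)
    (M : term) : pty -> Prop :=
  fun A' => exists Π, pd_of M Π /\ solves ψ (eqs Π) /\
    tree_eq t (reading ψ (ptree Π)) /\ env_in ψ (penv Π) γ /\ ψ (proot Π) = A'.

(** The counterpart for a derivation ending in (many); here the order of the received pre-types
    matters. *)
Definition realizers (ψ : nat -> pty) (γ : env (pty -> Prop)) (t : tree ty)
    (N : term) : list pty -> Prop :=
  fun σ => exists Πs, Forall (pd_of N) Πs /\ solves ψ (flat_map eqs Πs) /\
    tree_eq t (reading ψ (ptree_many N Πs)) /\
    env_in ψ (ebig (map penv Πs)) γ /\ map (fun Π => ψ (proot Π)) Πs = σ.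

(** * Environments of total sets and solutions of equations *)

Definition total_env (Γ : env ty) (γ : env (pty -> Prop)) : Prop :=
  forall x, matching total (Γ x) (γ x).

(** The sets given to a variable are shared out between the two premises. The split is made
    separately for each variable, hence the appeal to choice. *)
Lemma total_env_ecat Γ Δ γ :
  total_env (ecat Γ Δ) γ ->
  exists γ1 γ2, total_env Γ γ1 /\ total_env Δ γ2 /\
    forall x, Permutation (γ1 x ++ γ2 x) (γ x).
Proof.
  intros H.
  assert (W : forall x, exists p, matching total (Γ x) (fst p) /\
    matching total (Δ x) (snd p) /\ Permutation (fst p ++ snd p) (γ x)).
  { intros x. destruct (matching_app_inv _ _ _ _ (H x)) as (m1 & m2 & W).
    now exists (m1, m2). }
  pose (f x := proj1_sig (constructive_indefinite_description _ (W x))).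
  assert (Hf : forall x, matching total (Γ x) (fst (f x)) /\
    matching total (Δ x) (snd (f x)) /\
    Permutation (fst (f x) ++ snd (f x)) (γ x)).
  { intros x. unfold f. now destruct constructive_indefinite_description. }
  exists (fun x => fst (f x)), (fun x => snd (f x)).
  repeat split; intros x; apply Hf.
Qed.

Lemma total_env_eq Γ Δ γ :
  (forall x, matching ty_eq (Γ x) (Δ x)) -> total_env Γ γ -> total_env Δ γ.
Proof. intros H T x. now apply matching_total_ty_eq with (Γ x). Qed.

Lemma env_in_ecat ψ E1 E2 γ1 γ2 γ :
  env_in ψ E1 γ1 -> env_in ψ E2 γ2 ->
  (forall x, Permutation (γ1 x ++ γ2 x) (γ x)) -> env_in ψ (ecat E1 E2) γ.
Proof.
  intros H1 H2 P x. apply matching_perm_r with (γ1 x ++ γ2 x); trivial.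
  unfold ecat. rewrite map_app. now apply matching_app.
Qed.

Lemma solves_app ψ E F : solves ψ (E ++ F) <-> solves ψ E /\ solves ψ F.
Proof.
  split.
  - intros H. split; intros A B HAB; apply H, in_or_app; auto.
  - intros [HE HF] A B HAB. apply in_app_or in HAB as [H|H]; auto.
Qed.

Lemma solves_cons ψ A B E :
  solves ψ ((A, B) :: E) <-> psubst ψ A = psubst ψ B /\ solves ψ E.
Proof.
  split.
  - intros H. split; [|intros C D HCD]; apply H; simpl; auto.
  - intros [H HE] C D [HCD|HCD]; auto. now injection HCD as <- <-.
Qed.

Lemma solves_perm ψ E F : Permutation E F -> solves ψ E -> solves ψ F.
Proof. intros P H A B HAB. apply H. now rewrite P. Qed.

Lemma ebig_perm {X} (Γs Δs : list (env X)) x :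
  Permutation Γs Δs -> Permutation (ebig Γs x) (ebig Δs x).
Proof.
  intros P. induction P; simpl; unfold ecat; trivial.
  - now apply Permutation_app_head.
  - rewrite !app_assoc. apply Permutation_app_tail, Permutation_app_comm.
  - now transitivity (ebig l' x).
Qed.

(** * The fundamental lemma: realizers form total sets *)

Lemma realizer_full ψ γ t M Γ A A' :
  concl t = Judg Γ M (inl A) -> realizer ψ γ t M A' -> full A A'.
Proof.
  intros Et (Π & _ & _ & H & _ & <-). apply tree_eq_concl in H as (_ & _ & H).
  unfold reading in H. now rewrite !concl_tree_map, concl_ptree, Et in H.
Qed.

(** Premises are realized independently, each with its own share of [γ]. So [Us] lists their sets of
    realizers in the order of the premises, and any choice of one element in each is realized. The
    comparison of environments serves the conclusion of (many). *)
Lemma realizers_of_premises ψ γ N ds ps :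
  Forall2 (fun d p => forall γ', total_env (fst p) γ' ->
    total (snd p) (realizer ψ γ' d N)) ds ps ->
  map concl ds = map (fun p => Judg (fst p) N (inl (snd p))) ps ->
  total_env (ebig (map fst ps)) γ ->
  exists Us, Forall2 total (map snd ps) Us /\
    forall σ, Forall2 (fun A U => U A) σ Us ->
    exists Πs, Forall (pd_of N) Πs /\ solves ψ (flat_map eqs Πs) /\
      Forall2 (fun d Π => tree_eq d (reading ψ (ptree Π))) ds Πs /\
      env_in ψ (ebig (map penv Πs)) γ /\
      (forall x, matching ty_eq (ebig (map fst ps) x)
         (map collapse (map (psubst ψ) (ebig (map penv Πs) x)))) /\
      map (fun Π => ψ (proot Π)) Πs = σ.
Proof.
  intros H. revert γ. induction H as [|d [Γ A] ds ps Hd H IH]; intros γ Eds Hγ.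
  - exists []. split; [constructor|]. intros σ Hσ. inversion Hσ; subst.
    exists []. split; [constructor|]. split; [intros ? ? []|].
    split; [constructor|]. split; [|split; trivial; intros x; now apply matching_nil].
    intros x. specialize (Hγ x). simpl in *. apply matching_nil in Hγ.
    rewrite Hγ. now apply matching_nil.
  - simpl in Eds, Hd. injection Eds as Ed Eds.
    apply total_env_ecat in Hγ as (γ1 & γ2 & Hγ1 & Hγ2 & P).
    destruct (IH γ2 Eds Hγ2) as (Us & HUs & HR).
    exists (realizer ψ γ1 d N :: Us). split; [simpl; auto|].
    intros σ Hσ. inversion Hσ as [|A' ? σ' ? HA' Hσ']; subst.
    destruct HA' as (Π & H1 & H2 & H3 & H4 & <-).
    destruct (HR σ' Hσ') as (Πs & K1 & K2 & K3 & K4 & K5 & <-).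
    exists (Π :: Πs). split; [auto|]. split; [now apply solves_app|].
    split; [auto|]. split; [now apply env_in_ecat with γ1 γ2|]. split; [|trivial].
    intros x. simpl. unfold ecat. rewrite !map_app. apply matching_app; trivial.
    apply tree_eq_concl in H3 as [H3 _]. specialize (H3 x).
    unfold reading in H3. rewrite !concl_tree_map, concl_ptree, Ed in H3.
    now apply mset_eq_matching in H3.
Qed.

Lemma judg_eq_inl j Γ M A :
  judg_eq j (Judg Γ M (inl A)) ->
  exists Γ' A', j = Judg Γ' M (inl A') /\ (forall x, matching ty_eq (Γ' x) (Γ x)) /\
    ty_eq A' A.
Proof.
  destruct j as [Γ' M' [A'|σ]]; intros (H1 & H2 & H3); simpl in *; [|easy].
  subst. exists Γ', A'. repeat split; trivial. intros x. now apply mset_eq_matching.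
Qed.

Lemma judg_eq_inr j Γ M μ :
  judg_eq j (Judg Γ M (inr μ)) ->
  exists Γ' ν, j = Judg Γ' M (inr ν) /\ (forall x, matching ty_eq (Γ' x) (Γ x)) /\
    matching ty_eq ν μ.
Proof.
  destruct j as [Γ' M' [A'|ν]]; intros (H1 & H2 & H3); simpl in *; [easy|].
  subst. exists Γ', ν. repeat split; trivial; intros; now apply mset_eq_matching.
Qed.

(** By induction on the derivation. For (many), every ordering [σ] of a choice from [Us] is
    realized, since the premises may be permuted; this freedom lets the argument of an application
    follow the order imposed by the function. *)
Lemma realizers_total ψ t :
  (forall A, exists a, ψ a = A) -> Nder t ->
  (forall Γ M A γ, concl t = Judg Γ M (inl A) -> total_env Γ γ ->
     total A (realizer ψ γ t M)) /\
  (forall Γ M μ γ, concl t = Judg Γ M (inr μ) -> total_env Γ γ ->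
     exists Us, matching total μ Us /\
       forall σ, matching (fun A U => U A) σ Us -> realizers ψ γ t M σ).
Proof.
  intros Hψ. induction t as [r j ts IH] using tree_nested_ind. intros Ht.
  inversion Ht as [j' x A Hj|j' x Γ M A d Hd Ed Hj|j' M ps ds Hds Eds Hj
    |j' Γ Δ M N μ ν A d1 d2 H1 E1 H2 E2 Hμν Hj]; subst; simpl concl.
  - apply judg_eq_inl in Hj as (Γ & A' & -> & HΓ & HA).
    split; [|discriminate]. intros Γ' M' A0 γ [= <- <- <-] Hγ.
    apply (total_ty_eq _ A); [trivial|].
    assert (Hx := total_env_eq _ _ _ HΓ Hγ).
    assert (Hxx := Hx x). unfold esingle in Hxx.
    destruct (Nat.eq_dec x x) as [_|]; [|easy].
    apply matching_singleton in Hxx as (U & EU & HU).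
    (* A variable can receive every element of the set [U] assigned to its only occurrence, so its
       realizers include the total set [U]. *)
    apply total_mono with U; trivial.
    + intros B HB. destruct (Hψ B) as [a <-]. exists (PVar a x).
      split; [reflexivity|]. split; [intros ? ? []|]. split; [|split; trivial].
      * constructor; [easy| |constructor]. split; [|split; trivial]; simpl.
        -- intros y. apply mset_eq_matching. specialize (HΓ y).
           unfold esingle in *. destruct (Nat.eq_dec y x); trivial.
           apply matching_ty_eq_trans with [A]; trivial. apply matching_singleton.
           eexists. split; [reflexivity|]. apply (total_full _ _ _ HU HB).
        -- apply ty_eq_trans with A; trivial. apply (total_full _ _ _ HU HB).
      * intros y. simpl. specialize (Hx y). unfold esingle in *.
        destruct (Nat.eq_dec y x) as [->|].
        -- rewrite EU. apply matching_singleton. eauto.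
        -- apply matching_nil in Hx. rewrite Hx. now apply matching_nil.
    + intros B HB. apply ty_eq_trans with A'; [now apply ty_eq_sym|].
      eapply realizer_full; [|exact HB]. reflexivity.
  - apply judg_eq_inl in Hj as (Γ' & A' & -> & HΓ & HA).
    split; [|discriminate]. intros Γ0 M' A0 γ [= <- <- <-] Hγ.
    apply (total_ty_eq (TArr (Γ x) A)); [now apply ty_eq_sym|].
    assert (Hfull : forall B, realizer ψ γ (Node Rabs
      (Judg Γ' (Lam x M) (inl A')) [d]) (Lam x M) B -> full (TArr (Γ x) A) B).
    { intros B HB. apply ty_eq_trans with A'; [now apply ty_eq_sym|].
      eapply realizer_full; [|exact HB]. reflexivity. }
    apply total_arr. split; trivial. intros Us HUs.
    inversion IH as [|? ? IHd _]; subst. destruct (IHd Hd) as [IHd' _].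
    (* Inside the body, the occurrences of [x] draw their types from the argument sets [Us]. *)
    pose (γ' y := if Nat.eq_dec y x then Us else γ y).
    apply total_mono with (realizer ψ γ' d M).
    + apply IHd' with Γ; trivial. intros y. unfold γ'.
      destruct (Nat.eq_dec y x) as [->|Hy]; trivial.
      apply matching_total_ty_eq with (Γ' y); trivial.
      specialize (HΓ y). unfold eremove in HΓ. now destruct (Nat.eq_dec y x).
    (* The domain is ordered like the occurrences of [x] in the realizer of the body. *)
    + intros B (Π & K1 & K2 & K3 & K4 & <-). exists (map (psubst ψ) (penv Π x)).
      split.
      * specialize (K4 x). unfold γ' in K4. now destruct (Nat.eq_dec x x).
      (* A label that [ψ] decodes to this arrow solves the equation of (abs). *)
      * destruct (Hψ (PTArr (map (psubst ψ) (penv Π x)) (ψ (proot Π)))) as [b Hb].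
        exists (PAbs b x Π). split; [now split|]. split; [now apply solves_cons|].
        split; [|split; trivial].
        -- constructor; [easy| |now repeat constructor].
           apply tree_eq_concl in K3 as (L1 & _ & L3). unfold reading in L1, L3.
           rewrite !concl_tree_map, concl_ptree, Ed in L1, L3. simpl in L1, L3.
           split; [|split]; simpl.
           ++ intros y. apply mset_eq_matching. specialize (L1 y).
              specialize (HΓ y). unfold eremove in *. rewrite mset_eq_matching in L1.
              destruct (Nat.eq_dec y x); trivial.
              now apply matching_ty_eq_trans with (Γ y).
           ++ now rewrite (pd_of_psubj _ _ K1).
           ++ rewrite Hb. apply ty_eq_trans with (TArr (Γ x) A); trivial.
              now constructor.
        -- intros y. specialize (K4 y). unfold γ' in K4. simpl. unfold eremove.
           destruct (Nat.eq_dec y x); trivial. simpl.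
           (* Here [y] is [x]: [Γ' y] is empty, and hence so is [γ y]. *)
           specialize (Hγ y). specialize (HΓ y). unfold eremove in HΓ.
           destruct (Nat.eq_dec y x); [|easy]. apply matching_flip, matching_nil in HΓ.
           rewrite HΓ in Hγ. apply matching_nil in Hγ. rewrite Hγ.
           now apply matching_nil.
    + intros B (σ & _ & HB). apply Hfull in HB. now inversion HB.
  - apply judg_eq_inr in Hj as (Γ & μ & -> & HΓ & Hμ).
    split; [discriminate|]. intros Γ' M' μ' γ [= <- <- <-] Hγ.
    apply (total_env_eq _ _ _ HΓ) in Hγ.
    assert (IHds : Forall2 (fun d p => forall γ', total_env (fst p) γ' ->
      total (snd p) (realizer ψ γ' d M)) ts ps).
    { clear -IH Hds Eds. revert ps Eds. induction ts as [|d ts IHts];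
        intros [|p ps] Eds; try discriminate; constructor; simpl in Eds;
        injection Eds as Ed Eds; inversion IH; subst; inversion Hds; subst.
      - intros γ' Hγ'. now apply H1 with (fst p).
      - now apply IHts. }
    destruct (realizers_of_premises _ _ _ _ _ IHds Eds Hγ) as (Us & HUs & HR).
    exists Us. split.
    + apply matching_total_ty_eq with (map snd ps); [now apply matching_ty_eq_sym|].
      now apply Forall2_matching.
    + intros σ Hσ. assert (Hfull : matching ty_eq μ (map collapse σ)).
      { apply matching_ty_eq_trans with (map snd ps); trivial.
        apply matching_full with Us; trivial. now apply Forall2_matching. }
      (* First realize the ordering [σ'] that follows the premises, then permute the
         pseudo-derivations to obtain [σ]. *)
      apply matching_flip in Hσ as (σ' & Hσ' & P). apply Forall2_flip in Hσ'.
      destruct (HR σ' Hσ') as (Πs & K1 & K2 & K3 & K4 & K5 & <-).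
      symmetry in P. apply Permutation_map_inv in P as (Πs' & -> & P).
      assert (Penv : forall x,
        Permutation (ebig (map penv Πs) x) (ebig (map penv Πs') x)).
      { intros x. now apply ebig_perm, Permutation_map. }
      exists Πs'. split; [now apply (Permutation_Forall P)|].
      split; [|split; [|split; trivial]].
      * apply solves_perm with (flat_map eqs Πs); trivial.
        now apply Permutation_flat_map.
      * constructor.
        -- split; [|split]; simpl; trivial.
           ++ intros x. apply mset_eq_matching.
              apply matching_ty_eq_trans with (ebig (map fst ps) x); trivial.
              eapply matching_perm_r; [apply K5|]. now do 2 apply Permutation_map.
           ++ apply mset_eq_matching. now rewrite !map_map in *.
        -- apply mset_eq_matching. rewrite !map_map.
           apply (matching_map_r tree_eq (fun Π => reading ψ (ptree Π))).
           exists Πs. auto.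
      * intros x. eapply matching_perm_l; [apply K4|]. now apply Permutation_map.
  - apply judg_eq_inl in Hj as (Γ' & A' & -> & HΓ & HA).
    split; [|discriminate]. intros Γ0 M' A0 γ [= <- <- <-] Hγ.
    apply (total_ty_eq A); [now apply ty_eq_sym|].
    apply (total_env_eq _ _ _ HΓ), total_env_ecat in Hγ
      as (γ1 & γ2 & Hγ1 & Hγ2 & P).
    inversion IH as [|? ? IH1 IH']; subst. inversion IH' as [|? ? IH2 _]; subst.
    destruct (IH1 H1) as [IH1' _]. destruct (IH2 H2) as [_ IH2'].
    specialize (IH1' _ _ _ _ E1 Hγ1).
    destruct (IH2' _ _ _ _ E2 Hγ2) as (Us & HUs & HR).
    apply mset_eq_matching, matching_ty_eq_sym in Hμν.
    (* The function is fed the sets [Us] provided by the argument: it picks an ordered [σ], and the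
       argument can be realized in that very order. *)
    assert (HX := proj2 (proj1 (total_arr _ _ _) IH1') Us
      (matching_total_ty_eq _ _ _ Hμν HUs)).
    apply (total_mono _ _ _ HX).
    + intros B (σ & Hσ & Π & K1 & K2 & K3 & K4 & K5).
      destruct (HR σ Hσ) as (Πs & L1 & L2 & L3 & L4 & <-).
      destruct (Hψ B) as [c Hc]. exists (PApp c Π N Πs).
      split; [now repeat split|]. split; [|split; [|split; trivial]].
      * simpl. apply solves_cons. rewrite solves_app. split; [|now split].
        simpl. now rewrite K5, Hc, map_map.
      * assert (C1 := tree_eq_concl _ _ K3). assert (C2 := tree_eq_concl _ _ L3).
        constructor; [easy| |now repeat constructor].
        unfold reading in C1, C2. rewrite !concl_tree_map, concl_ptree, E1 in C1.
        rewrite E2 in C2. destruct C1 as (C1 & _ & C1'). destruct C2 as (C2 & _).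
        simpl in C1, C1', C2.
        split; [|split]; simpl.
        -- intros x. apply mset_eq_matching.
           apply matching_ty_eq_trans with (ecat Γ Δ x); trivial.
           unfold ecat. rewrite !map_app.
           apply matching_app; apply mset_eq_matching; auto.
        -- now rewrite (pd_of_psubj _ _ K1).
        -- rewrite K5 in C1'. inversion C1'; subst.
           now apply ty_eq_trans with A.
      * now apply env_in_ecat with γ1 γ2.
    + intros B HB. apply ty_eq_trans with A'; [now apply ty_eq_sym|].
      eapply realizer_full; [|exact HB]. reflexivity.
Qed.

(** * Relabelling *)

(** [f] may identify labels, since those of a realizer can repeat. *)
Fixpoint relabel (f : nat -> nat) (Π : pd) : pd :=
  match Π with
  | PVar a x => PVar (f a) x
  | PAbs b x Σ => PAbs (f b) x (relabel f Σ)
  | PApp c Σ N Σs => PApp (f c) (relabel f Σ) N (map (relabel f) Σs)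
  end.

Definition shape : pd -> pd := relabel (fun _ => 0).

Lemma relabel_ext f g Π :
  (forall a, In a (pvars Π) -> f a = g a) -> relabel f Π = relabel g Π.
Proof.
  induction Π as [a x|b x Σ IH|c Σ N Σs IH IHs] using pd_nested_ind; simpl; intros H.
  - now rewrite H by auto.
  - rewrite H by auto. rewrite IH; auto.
  - rewrite H by auto. rewrite IH by auto using in_or_app. f_equal.
    rewrite Forall_forall in IHs. apply map_ext_in. intros Σ' HΣ'. apply IHs; trivial.
    intros a Ha. apply H. right. apply in_or_app. right. apply in_flat_map. eauto.
Qed.

Lemma relabel_list_exists Σs Πs :
  ForallOrdPairs pdisjoint Σs ->
  Forall2 (fun Σ Π => exists f, relabel f Σ = Π) Σs Πs ->
  exists f, map (relabel f) Σs = Πs.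
Proof.
  intros D H. induction H as [|Σ Π Σs Πs [f Hf] _ IH].
  - now exists (fun a => a).
  - inversion D as [|? ? DΣ DΣs]; subst. destruct (IH DΣs) as [g <-].
    exists (fun a => if in_dec Nat.eq_dec a (pvars Σ) then f a else g a).
    simpl. f_equal.
    + apply relabel_ext. intros a Ha. now destruct in_dec.
    + apply map_ext_in. intros Σ' HΣ'. rewrite Forall_forall in DΣ.
      apply relabel_ext. intros a Ha. destruct in_dec as [i|]; trivial.
      now destruct (DΣ Σ' HΣ' a).
Qed.

(** In a pseudo-derivation every node has its own label, so a new label can be prescribed at each
    node: functions obtained for disjoint subtrees are glued by testing which subtree contains the
    variable. *)
Lemma relabel_exists Π Π' :
  is_pd Π -> shape Π = shape Π' -> exists f, relabel f Π = Π'.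
Proof.
  unfold shape. revert Π'.
  induction Π as [a x|b x Σ IH|c Σ N Σs IH IHs] using pd_nested_ind;
    intros [a' y|b' y Σ'|c' Σ' N' Σs'] H E; try discriminate; simpl in E.
  - injection E as <-. now exists (fun _ => a').
  - injection E as <- E. inversion H; subst. destruct (IH Σ') as [f <-]; trivial.
    exists (fun a => if Nat.eq_dec a b then b' else f a). simpl.
    destruct Nat.eq_dec; [|easy]. f_equal. apply relabel_ext. intros a Ha.
    destruct Nat.eq_dec; congruence.
  - injection E as E <- Es. inversion H as [| |? ? ? ? H1 H2 _ H3 H4 H5 H6]; subst.
    destruct (IH Σ') as [f <-]; trivial.
    destruct (relabel_list_exists Σs Σs') as [g <-]; trivial.
    { clear -IHs Es H2. revert Σs' Es. induction Σs as [|Σ Σs IHΣs];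
        intros [|Σ' Σs'] Es; try discriminate; constructor; simpl in Es;
        injection Es as E Es; inversion IHs; subst; inversion H2; subst; auto. }
    exists (fun a => if Nat.eq_dec a c then c' else
      if in_dec Nat.eq_dec a (pvars Σ) then f a else g a). simpl.
    rewrite Forall_forall in H4, H6. destruct Nat.eq_dec; [|easy]. f_equal.
    + apply relabel_ext. intros a Ha. destruct Nat.eq_dec; [congruence|].
      now destruct in_dec.
    + apply map_ext_in. intros Σ' HΣ'. apply relabel_ext. intros a Ha.
      destruct Nat.eq_dec as [->|]; [now destruct (H6 Σ' HΣ')|].
      destruct in_dec as [i|]; trivial. now destruct (H4 Σ' HΣ' a).
Qed.

(** * Relabelling as precomposition of the substitution *)

Lemma penv_relabel f ψ Π x :
  map (psubst ψ) (penv (relabel f Π) x) = map (psubst (fun a => ψ (f a))) (penv Π x).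
Proof.
  induction Π as [a y|b y Σ IH|c Σ N Σs IH IHs] using pd_nested_ind; simpl.
  - unfold esingle. now destruct Nat.eq_dec.
  - unfold eremove. now destruct Nat.eq_dec.
  - unfold ecat. rewrite !map_app, IH. f_equal.
    induction IHs as [|Σ' Σs HΣ' _ IHs]; simpl; trivial.
    unfold ecat. now rewrite !map_app, HΣ', IHs.
Qed.

Lemma ebig_penv_relabel f ψ Πs x :
  map (psubst ψ) (ebig (map penv (map (relabel f) Πs)) x) =
  map (psubst (fun a => ψ (f a))) (ebig (map penv Πs) x).
Proof.
  induction Πs as [|Π Πs IH]; simpl; trivial.
  unfold ecat. now rewrite !map_app, penv_relabel, IH.
Qed.

Lemma proot_relabel f Π : proot (relabel f Π) = f (proot Π).
Proof. now destruct Π. Qed.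

Lemma psubj_relabel f Π : psubj (relabel f Π) = psubj Π.
Proof.
  induction Π using pd_nested_ind; simpl; congruence.
Qed.

Lemma pconcl_relabel f ψ Π :
  judg_map (psubst ψ) (pconcl (relabel f Π)) =
  judg_map (psubst (fun a => ψ (f a))) (pconcl Π).
Proof.
  unfold judg_map, pconcl, ptype. simpl. rewrite psubj_relabel, proot_relabel.
  f_equal. extensionality x. apply penv_relabel.
Qed.

Lemma ptypes_relabel f ψ Πs :
  map (psubst ψ) (map ptype (map (relabel f) Πs)) =
  map (psubst (fun a => ψ (f a))) (map ptype Πs).
Proof.
  rewrite !map_map. apply map_ext. intros Π. unfold ptype. now rewrite proot_relabel.
Qed.

Lemma ptree_relabel f ψ Π :
  tree_map (psubst ψ) (ptree (relabel f Π)) =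
  tree_map (psubst (fun a => ψ (f a))) (ptree Π).
Proof.
  induction Π as [a y|b y Σ IH|c Σ N Σs IH IHs] using pd_nested_ind;
    simpl tree_map; f_equal.
  - apply (pconcl_relabel f ψ (PVar a y)).
  - apply (pconcl_relabel f ψ (PAbs b y Σ)).
  - now rewrite IH.
  - apply (pconcl_relabel f ψ (PApp c Σ N Σs)).
  - rewrite IH. do 3 f_equal.
    + unfold judg_map. simpl. rewrite ptypes_relabel. f_equal. extensionality x.
      apply ebig_penv_relabel.
    + rewrite !map_map. apply map_ext_Forall. trivial.
Qed.

Lemma solves_relabel f ψ Π :
  solves ψ (eqs (relabel f Π)) -> solves (fun a => ψ (f a)) (eqs Π).
Proof.
  induction Π as [a y|b y Σ IH|c Σ N Σs IH IHs] using pd_nested_ind;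
    simpl; intros H.
  - intros ? ? [].
  - apply solves_cons in H as [H H']. apply solves_cons. split; [|auto].
    simpl in *. now rewrite proot_relabel, penv_relabel in H.
  - apply solves_cons in H as [H H']. apply solves_app in H' as [H1 H2].
    apply solves_cons. split; [|apply solves_app; split; auto].
    + simpl in *. now rewrite proot_relabel, ptypes_relabel in H.
    + clear H H1 IH. induction IHs as [|Σ' Σs HΣ' _ IHs]; simpl in *; [intros ? ? []|].
      apply solves_app in H2 as [H1 H2]. apply solves_app. auto.
Qed.

(** * Reaching every shape *)

(** The effect of a single expansion or erasure on shapes. *)
Inductive step : pd -> pd -> Prop :=
| step_many c Σ N Σs p :
    Σs <> [] -> p <> length Σs ->
    step (PApp c Σ N Σs) (PApp c Σ N (repeat (shape (pdmin 0 N)) p))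
| step_abs b x Σ Σ' : step Σ Σ' -> step (PAbs b x Σ) (PAbs b x Σ')
| step_fun c Σ Σ' N Σs : step Σ Σ' -> step (PApp c Σ N Σs) (PApp c Σ' N Σs)
| step_arg c Σ N Σs1 Σ1 Σ1' Σs2 :
    step Σ1 Σ1' ->
    step (PApp c Σ N (Σs1 ++ Σ1 :: Σs2)) (PApp c Σ N (Σs1 ++ Σ1' :: Σs2)).

Definition steps : pd -> pd -> Prop := clos_refl_trans pd step.

Lemma steps_congr (F : pd -> pd) :
  (forall Π Π', step Π Π' -> step (F Π) (F Π')) ->
  forall Π Π', steps Π Π' -> steps (F Π) (F Π').
Proof.
  intros HF Π Π' H. induction H as [? ? H| |].
  - apply rt_step. auto.
  - apply rt_refl.
  - eapply rt_trans; eassumption.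
Qed.

Lemma steps_args c Σ N Σs Σs' :
  Forall2 steps Σs Σs' -> steps (PApp c Σ N Σs) (PApp c Σ N Σs').
Proof.
  (* Generalized over a prefix [l] of premises already transformed. *)
  intros H. enough (W : forall l, steps (PApp c Σ N (l ++ Σs)) (PApp c Σ N (l ++ Σs')))
    by apply (W []).
  induction H as [|Π Π' Σs Σs' H _ IH]; intros l.
  - apply rt_refl.
  - apply rt_trans with (PApp c Σ N (l ++ Π' :: Σs)).
    + apply (steps_congr (fun Π => PApp c Σ N (l ++ Π :: Σs))); trivial.
      intros. now constructor.
    + specialize (IH (l ++ [Π'])). now rewrite <- !app_assoc in IH.
Qed.

Lemma shape_pdmin_any k l M : shape (pdmin k M) = shape (pdmin l M).
Proof.
  unfold shape. revert k l.
  induction M as [x|x M IH|P IHP Q IHQ]; intros k l; simpl; trivial.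
  - now rewrite (IH _ (S l)).
  - now rewrite (IHP _ (S l)), (IHQ _ (S l + tsize P)).
Qed.

Lemma shape_of_pdmin k M Π : is_pdmin M Π -> shape Π = shape (pdmin k M).
Proof.
  intros (H & <- & U). revert k.
  induction U as [a x|b x Σ U IH|c Σ N Σ' U IH U' IH']; intros k; unfold shape; simpl;
    inversion H as [| |? ? ? ? HΣ HΣs HN]; subst; trivial.
  - f_equal. now apply IH.
  - inversion HN as [|? ? <-]; subst. inversion HΣs; subst.
    f_equal; [now apply IH|]. f_equal. now apply IH'.
Qed.

(** Outermost first: an operation replaces all premises of a (many) by minimal ones, so their number
    is adjusted before each of them is developed recursively. *)
Lemma pdmin_steps M Π : pd_of M Π -> steps (shape (pdmin 0 M)) (shape Π).
Proof.
  revert Π. induction M as [x|x M IH|P IHP Q IHQ]; intros [b y|b y Σ|c Σ N Σs];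
    simpl; try easy.
  - intros ->. apply rt_refl.
  - intros [-> H]. unfold shape. simpl.
    apply (steps_congr (PAbs 0 x)); [now constructor|].
    rewrite (shape_pdmin_any 1 0 M : relabel _ _ = _). now apply IH.
  - intros (HΣ & -> & HΣs). unfold shape. simpl.
    apply rt_trans with (PApp 0 (shape Σ) Q [shape (pdmin (S (tsize P)) Q)]).
    + apply (steps_congr (fun Π => PApp 0 Π Q _)); [now constructor|].
      rewrite (shape_pdmin_any 1 0 P : relabel _ _ = _). now apply IHP.
    + rewrite (shape_pdmin_any _ 0 Q).
      apply rt_trans with (PApp 0 (shape Σ) Q (repeat (shape (pdmin 0 Q)) (length Σs))).
      (* The minimal pseudo-derivation already has one premise; any other number is reached by a
         single [step_many]. *)
      * destruct (Nat.eq_dec (length Σs) 1) as [->|]; [apply rt_refl|].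
        apply rt_step. now constructor.
      * apply steps_args. induction HΣs; simpl; constructor; auto.
Qed.

(** * From steps on shapes to expansions and erasures *)

Lemma ForallOrdPairs_elt {X} (R : X -> X -> Prop) l x l' :
  ForallOrdPairs R (l ++ x :: l') ->
  Forall (fun y => R y x) l /\ Forall (R x) l'.
Proof.
  induction l as [|y l IH]; simpl; intros H; inversion H as [|? ? Hy H']; subst.
  - auto.
  - apply IH in H' as [H1 H2]. split; trivial. constructor; trivial.
    rewrite Forall_forall in Hy. apply Hy, in_elt.
Qed.

Lemma shape_copies k N p : map shape (copies k N p) = repeat (shape (pdmin 0 N)) p.
Proof.
  unfold copies. rewrite map_map. generalize 0 at 1.
  induction p as [|p IH]; intros s; simpl; trivial.
  rewrite IH. f_equal. apply shape_pdmin_any.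
Qed.

Lemma proot_pvars Π : In (proot Π) (pvars Π).
Proof. destruct Π; simpl; auto. Qed.

Lemma map_replace_many_id a σ p k Σs :
  Forall (fun Σ => ~ In a (pvars Σ)) Σs ->
  map (replace_many (a :: σ) p k) Σs = Σs.
Proof.
  intros H. induction H as [|Σ Σs HΣ _ IH]; simpl; trivial.
  now rewrite IH, replace_many_id.
Qed.

(** The root label [a] of the first premise singles out the (many) to be replaced, since labels are
    distinct. The condition [a <> proot Π] is for the induction: it prevents a match at an enclosing
    (many) whose first premise contains the target. *)
Lemma step_replace_many Π s :
  step (shape Π) s -> is_pd Π ->
  exists a σ p, In a (pvars Π) /\ a <> proot Π /\ p <> S (length σ) /\
    forall k, shape (replace_many (a :: σ) p k Π) = s.
Proof.
  intros H. remember (shape Π) as s0 eqn:E. revert Π E. unfold shape.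
  induction H as [c Σ N Σs p Hnil Hp|b x Σ Σ' _ IH|c Σ Σ' N Σs _ IH
    |c Σ N Σs1 Σ1 Σ1' Σs2 _ IH];
    intros [a0 y|b0 y Π|c0 Π N0 Πs] E H; try discriminate; injection E; clear E;
    inversion H as [|? ? ? H1 H2|? ? ? ? H1 H2 _ H3 H4 H5 H6]; subst.
  - intros -> -> -> ->. destruct Πs as [|Π' Πs]; [easy|].
    exists (proot Π'), (map proot Πs), p. cbn [replace_many pvars proot].
    assert (Hin : In (proot Π') (pvars Π ++ pvars Π' ++ flat_map pvars Πs)).
    { rewrite !in_app_iff. auto using proot_pvars. }
    split; [now right|]. split; [|split].
    + inversion H6; subst. intros E. pose proof (proot_pvars Π') as K.
      rewrite E in K. contradiction.
    + simpl in Hp. now rewrite !length_map in *.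
    + intros k. destruct list_eq_dec as [_|n]; [|now destruct n]. simpl. f_equal.
      apply shape_copies.
  - intros -> -> ->. destruct (IH Π eq_refl H1) as (a & σ & p & Ha & _ & Hp & E).
    exists a, σ, p. cbn [replace_many pvars proot]. split; [|split; [|split; trivial]].
    + now right.
    + intros ->. contradiction.
    + intros k. simpl. f_equal. apply E.
  - intros -> -> -> ->. destruct (IH Π eq_refl H1) as (a & σ & p & Ha & _ & Hp & E).
    exists a, σ, p. cbn [replace_many pvars proot].
    assert (K : Forall (fun Σ => ~ In a (pvars Σ)) Πs).
    { eapply Forall_impl; [|exact H4]. simpl. auto. }
    split; [|split; [|split; trivial]].
    + right. apply in_or_app. now left.
    + intros ->. contradiction.
    + intros k. destruct list_eq_dec as [e|_].
      * destruct Πs as [|Π' Πs]; [easy|]. simpl in e. injection e as <- _.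
        inversion K as [|? ? K' _]; subst. destruct K'. apply proot_pvars.
      * simpl. now rewrite E, map_replace_many_id.
  - intros E -> -> ->. symmetry in E.
    apply map_eq_app in E as (Πs1 & Πs2' & -> & <- & E).
    apply map_eq_cons in E as (Π1 & Πs2 & -> & E1 & <-).
    assert (Hin := in_elt Π1 Πs1 Πs2).
    apply ForallOrdPairs_elt in H3 as [D1 D2].
    rewrite Forall_forall in H2, H4, H6.
    destruct (IH Π1) as (a & σ & p & Ha & Hroot & Hp & E); auto.
    exists a, σ, p. cbn [replace_many pvars proot].
    assert (K1 : Forall (fun Σ => ~ In a (pvars Σ)) Πs1).
    { eapply Forall_impl; [|exact D1]. simpl. intros Σ0 D K. now apply (D a). }
    assert (K2 : Forall (fun Σ => ~ In a (pvars Σ)) Πs2).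
    { eapply Forall_impl; [|exact D2]. simpl. auto. }
    split; [|split; [|split; trivial]].
    + right. apply in_or_app. right. apply in_flat_map. eauto.
    + intros ->. now destruct (H6 Π1 Hin).
    + intros k. destruct list_eq_dec as [e|_].
      (* The enclosing (many) is not a match: its first premise is [Π1], whose root is not [a], or a
         premise disjoint from [Π1]. *)
      * rewrite map_app in e. destruct Πs1 as [|Π0 Πs1]; simpl in e; injection e as <- _.
        -- easy.
        -- inversion K1 as [|? ? K' _]; subst. destruct K'. apply proot_pvars.
      * rewrite map_app. simpl map. rewrite !map_replace_many_id by trivial.
        rewrite (replace_many_id _ _ _ _ Π) by (intros K; now apply (H4 Π1 Hin a)).
        simpl. f_equal. rewrite map_app. simpl. now rewrite E.
Qed.

(** Comparing the wanted number [p] of premises with the current one selects an erasure or an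
    expansion; as they differ, its parameter is at least 1. *)
Lemma step_apply_op Π s :
  step (shape Π) s -> is_pd Π ->
  exists o, op_ok o /\ shape (apply_op o Π) = s.
Proof.
  intros H HΠ. destruct (step_replace_many _ _ H HΠ) as (a & σ & p & _ & _ & Hp & E).
  destruct (Nat.le_gt_cases p (length σ)).
  - exists (Er (a :: σ) (S (length σ) - p)). split; [split; [easy|lia]|].
    cbn [apply_op length]. replace (S (length σ) - (S (length σ) - p)) with p by lia.
    apply E.
  - exists (Exp (a :: σ) (p - S (length σ))). split; [split; [easy|lia]|].
    cbn [apply_op length].
    replace (S (length σ) + (p - S (length σ))) with p by lia.
    apply E.
Qed.

Lemma steps_apply_ops s s' :
  steps s s' -> forall Π, is_pd Π -> shape Π = s ->
  exists e, Forall op_ok e /\ is_pd (apply_ops e Π) /\ shape (apply_ops e Π) = s'.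
Proof.
  intros H. induction H as [s s' H|s|s s' s'' _ IH1 _ IH2]; intros Π HΠ E.
  - rewrite <- E in H. destruct (step_apply_op _ _ H HΠ) as (o & Ho & Es).
    exists [o]. simpl. repeat split; trivial; [now repeat constructor|].
    now apply apply_op_is_pd.
  - exists []. auto.
  - destruct (IH1 Π HΠ E) as (e1 & He1 & H1 & E1).
    destruct (IH2 _ H1 E1) as (e2 & He2 & H2 & E2).
    exists (e1 ++ e2). unfold apply_ops in *. rewrite fold_left_app.
    repeat split; trivial. now apply Forall_app.
Qed.

(** * Enumerating pre-types *)

(** Cantor pairing: the first component is [0] for a variable and a successor for an arrow; lists
    are nested pairs, with [0] for the empty list. *)
Fixpoint pty_code (A : pty) : nat :=
  match A with
  | PTVar a => to_nat (0, a)
  | PTArr σ B =>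
      to_nat (S (fold_right (fun C n => S (to_nat (pty_code C, n))) 0 σ), pty_code B)
  end.

Fixpoint pty_code_inj (A B : pty) {struct A} : pty_code A = pty_code B -> A = B.
Proof.
  destruct A as [a|σ A], B as [b|τ B]; intros H; cbn [pty_code] in H;
    apply to_nat_inj in H; try discriminate.
  - now injection H as ->.
  - apply pair_equal_spec in H as [Hσ HA]. apply Nat.succ_inj in Hσ.
    f_equal; [|now apply pty_code_inj].
    clear A B HA. revert τ Hσ.
    induction σ as [|A σ IH]; intros [|B τ] H; cbn [fold_right] in H;
      try discriminate; trivial.
    apply Nat.succ_inj, to_nat_inj, pair_equal_spec in H as [HA Hσ].
    f_equal; [now apply pty_code_inj|now apply IH].
Qed.

Lemma pty_enumeration : exists ψ : nat -> pty, forall A, exists a, ψ a = A.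
Proof.
  (* A preimage under the coding; off its range the value is arbitrary. *)
  exists (fun n => epsilon (inhabits (PTVar 0)) (fun A => pty_code A = n)).
  intros A. exists (pty_code A). apply pty_code_inj.
  apply (epsilon_spec _ (fun B => pty_code B = pty_code A)). eauto.
Qed.

(** * Assembling the solution *)

Theorem theorem3p12 (M : term) (Γ : env ty) (A : ty) (Σ : tree ty) (ΠM : pd)
    (hΣ : derivation_of Σ Γ M A) (hΠM : is_pdmin M ΠM) :
  exists (e : list op) (ψ : nat -> pty),
    solution e ψ ΠM /\
    tree_eq Σ (tree_map collapse (tree_map (psubst ψ) (ptree (apply_ops e ΠM)))).
Proof.
  destruct hΣ as [HΣ EΣ]. destruct pty_enumeration as [ψ Hψ].
  (* Occurrences of free variables are unconstrained: they take their types in the full sets. *)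
  assert (Hγ : total_env Γ (fun x => map full (Γ x))).
  { intros x. apply matching_map_r, Forall2_matching.
    induction (Γ x); constructor; [apply full_total_inhabited|trivial]. }
  destruct (realizers_total ψ Σ Hψ HΣ) as [H _].
  (* A total set is inhabited, which yields an ordered version [Π] of [Σ], possibly with repeated
     labels. *)
  destruct (proj2 (full_total_inhabited A) _ (H _ _ _ _ EΣ Hγ))
    as (A' & Π & HΠ & Hsol & Htree & _).
  assert (HΠM := hΠM). destruct HΠM as (HΠM & _ & _).
  (* Operations give [ΠM] the shape of [Π]; its labels being distinct, [Π] is then a relabelling of
     the result. *)
  destruct (steps_apply_ops _ _ (pdmin_steps _ _ HΠ) ΠM HΠM (shape_of_pdmin 0 _ _ hΠM))
    as (e & He & Hpd & Eshape).
  destruct (relabel_exists _ _ Hpd Eshape) as [f <-].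
  (* The relabelling is absorbed into the substitution. *)
  exists e, (fun a => ψ (f a)). split; [split|]; trivial.
  - now apply solves_relabel.
  - unfold reading in Htree. now rewrite ptree_relabel in Htree.
Qed.
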